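(* Let $f,g$ be mixed polynomials of $n$ variables $z=(z_1,\ldots,z_n)$, let $\varepsilon>0$, and let $\Phi=(f/|f|,\,g/|g|):S_\varepsilon\setminus K_{fg}\to T^2=S^1\times S^1$ be the Milnor fibration product map associated with $f,g$. A point $p\in S_\varepsilon\setminus K_{fg}$ is a singular point of $\Phi$ if and only if $p, v_f(p), v_g(p)$ are linearly dependent over $\mathbb{R}$ (as a family of three vectors of $\mathbb{C}^n$ regarded as a real vector space).
   Context: A mixed polynomial of $n$ variables is a function $f(z,\overline z)=\sum_{\nu,\mu}c_{\nu,\mu}z^\nu\overline z^\mu$ (finite sum, $c_{\nu,\mu}\in\mathbb{C}$, $\nu,\mu$ multi-indices of nonnegative integers), where $z=(z_1,\ldots,z_n)\in\mathbb{C}^n$, $\overline z=(\overline{z_1},\ldots,\overline{z_n})$, $z^\nu=z_1^{\nu_1}\cdots z_n^{\nu_n}$, $\overline z^\mu=\overline{z_1}^{\mu_1}\cdots\overline{z_n}^{\mu_n}$. $S_\varepsilon=\{z\in\mathbb{C}^n : \|z\|=\varepsilon\}$, and $K_{fg}=S_\varepsilon\cap (fg)^{-1}(0)$. The Milnor fibration product map associated with $f,g$ is the smooth map $\Phi=(f/|f|,g/|g|):S_\varepsilon\setminus K_{fg}\to S^1\times S^1$. A singular point of a smooth map into a surface is a point where its differential has rank $<2$. For a mixed polynomial $h$ and a point $z$ with $h(z,\overline z)\neq 0$, $v_h(z)\in\mathbb{C}^n$ is the vector whose $j$-th component is $$ i\left(\overline{\frac{\partial \log h}{\partial z_j}}-\frac{\partial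 \log h}{\partial \overline{z_j}}\right)(z,\overline z),$$ where $\partial/\partial z_j$ and $\partial/\partial\overline{z_j}$ are the Wirtinger derivatives ($z_j$ and $\overline{z_j}$ treated as independent variables) and $\log h$ is any local branch. *)

(* Defs.v *)
From HB Require Import structures.
From mathcomp Require Import all_boot all_order all_algebra.
From mathcomp Require Import complex.
From mathcomp Require Import all_classical all_reals all_analysis.
(* Not imported: its notations clash with those of mathcomp-analysis. *)
From mathcomp Require mpoly.

Set Implicit Arguments.
Unset Strict Implicit.
Unset Printing Implicit Defensive.

Import Order.TTheory GRing.Theory Num.Theory.
Import numFieldNormedType.Exports.

Local Open Scope classical_set_scope.
Local Open Scope complex_scope.
Local Open Scope ring_scope.

Section RealCoordinates.
Variable R : realType.

(* C^n is identified with R^(2n) by z = x + i y |-> (x, y); its topology and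
   its real differential structure are those of 'rV[R]_(n + n). *)
Definition real_coords n (z : 'rV[R[i]]_n) : 'rV[R]_(n + n) :=
  row_mx (map_mx (@complex.Re R) z) (map_mx (@complex.Im R) z).

Definition of_real_coords n (x : 'rV[R]_(n + n)) : 'rV[R[i]]_n :=
  \row_j (x 0 (lshift n j) +i* x 0 (rshift n j)).

Definition realify n m (F : 'rV[R[i]]_n -> 'rV[R[i]]_m)
    (x : 'rV[R]_(n + n)) : 'rV[R]_(m + m) :=
  real_coords (F (of_real_coords x)).

Definition re_fun n (L : 'rV[R[i]]_n -> R[i]) (x : 'rV[R]_(n + n)) : R :=
  complex.Re (L (of_real_coords x)).

Definition im_fun n (L : 'rV[R[i]]_n -> R[i]) (x : 'rV[R]_(n + n)) : R :=
  complex.Im (L (of_real_coords x)).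

(* Directional derivative, along the real direction v, of a complex-valued
   function. *)
Definition real_dderive n (L : 'rV[R[i]]_n -> R[i]) (v : 'rV[R]_(n + n))
    (p : 'rV[R[i]]_n) : R[i] :=
  'D_v (re_fun L) (real_coords p) +i* 'D_v (im_fun L) (real_coords p).

Definition d_x n (j : 'I_n) (L : 'rV[R[i]]_n -> R[i]) : 'rV[R[i]]_n -> R[i] :=
  real_dderive L (delta_mx 0 (lshift n j)).

Definition d_y n (j : 'I_n) (L : 'rV[R[i]]_n -> R[i]) : 'rV[R[i]]_n -> R[i] :=
  real_dderive L (delta_mx 0 (rshift n j)).

Definition wirtinger n (j : 'I_n) (L : 'rV[R[i]]_n -> R[i])
    (p : 'rV[R[i]]_n) : R[i] :=
  2%:R^-1 * (d_x j L p - 'i%C * d_y j L p).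

Definition wirtinger_bar n (j : 'I_n) (L : 'rV[R[i]]_n -> R[i])
    (p : 'rV[R[i]]_n) : R[i] :=
  2%:R^-1 * (d_x j L p + 'i%C * d_y j L p).

Definition cexp (w : R[i]) : R[i] :=
  (expR (complex.Re w))%:C * (cos (complex.Im w) +i* sin (complex.Im w)).

Definition is_local_log n (h : 'rV[R[i]]_n -> R[i]) (p : 'rV[R[i]]_n)
    (L : 'rV[R[i]]_n -> R[i]) : Prop :=
  \forall x \near real_coords p,
    [/\ {for x, continuous (re_fun L)}, {for x, continuous (im_fun L)} &
        cexp (L (of_real_coords x)) = h (of_real_coords x)].

(* v_h(p), computed from a local branch L of log h at p. *)
Definition v_vec n (L : 'rV[R[i]]_n -> R[i]) (p : 'rV[R[i]]_n) : 'rV[R[i]]_n :=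
  \row_j ('i%C * ((wirtinger j L p)^*%C - wirtinger_bar j L p)).

Definition enorm n (z : 'rV[R[i]]_n) : R :=
  Num.sqrt (\sum_j (complex.Re (z 0 j) ^+ 2 + complex.Im (z 0 j) ^+ 2)).

Definition csphere n (eps : R) : set 'rV[R[i]]_n := [set z | enorm z = eps].

(* The row space of this matrix is { v | Re <v, p> = 0 }, the tangent space at
   p of the sphere centred at 0 through p. *)
Definition sphere_tangent n (p : 'rV[R[i]]_n) : 'M[R]_(n + n) :=
  kermx (real_coords p)^T.

(* Rank of the differential at p of the restriction of F to the sphere through
   p, for F differentiable near p in C^n: the dimension of the image of the
   tangent space (row vectors v, with dF(v) = v *m 'J F). *)
Definition sphere_diff_rank n m (F : 'rV[R[i]]_n -> 'rV[R[i]]_m)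
    (p : 'rV[R[i]]_n) : nat :=
  \rank (sphere_tangent p *m jacobian (realify F) (real_coords p)).

Definition sphere_singular_point n m (F : 'rV[R[i]]_n -> 'rV[R[i]]_m)
    (p : 'rV[R[i]]_n) : Prop :=
  (sphere_diff_rank F p < 2)%N.

Definition real_dependent n (s : seq 'rV[R[i]]_n) : Prop :=
  ~~ free [seq real_coords v | v <- s].

End RealCoordinates.

Section MixedPolynomials.
Variables (R : realType) (n : nat).

(* A mixed polynomial is a polynomial in 2n variables: the first n stand for
   the z_j, the last n for their conjugates. *)
Definition mixed_poly : Type := mpoly.mpoly (n + n) R[i].

Definition mixed_eval (f : mixed_poly) (z : 'rV[R[i]]_n) : R[i] :=
  mpoly.meval (fun k : 'I_(n + n) =>
    match fintype.split k with inl j => z 0 j | inr j => (z 0 j)^*%C end) f.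

Definition milnor_link (f g : mixed_poly) (eps : R) : set 'rV[R[i]]_n :=
  csphere eps `&` [set z | mixed_eval f z * mixed_eval g z = 0].

(* (f / |f|, g / |g|), on all of { f g != 0 }. *)
Definition milnor_product_map (f g : mixed_poly) (z : 'rV[R[i]]_n) :
    'rV[R[i]]_2 :=
  \row_k (if k == 0 then mixed_eval f z / `|mixed_eval f z|
          else mixed_eval g z / `|mixed_eval g z|).

End MixedPolynomials.

(* Main.v *)
Require Import Defs.
From HB Require Import structures.
From mathcomp Require Import all_boot all_order all_algebra.
From mathcomp Require Import complex.
From mathcomp Require Import all_classical all_reals all_analysis.
From mathcomp Require Import ring zify.
From mathcomp Require mpoly.

Set Implicit Arguments.
Unset Strict Implicit.
Unset Printing Implicit Defensive.

Import Order.TTheory GRing.Theory Num.Theory.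
Import numFieldNormedType.Exports.

Local Open Scope classical_set_scope.
Local Open Scope complex_scope.
Local Open Scope ring_scope.

(** Near p each map h / |h| is exp(i theta), where theta = Im (log h) for a
    continuous branch of log h, so Phi is the composite of (theta_f, theta_g)
    with the local parametrisation (s, t) |-> (exp(i s), exp(i t)) of the torus.
    The latter is an immersion, hence the differential of Phi on the tangent
    space of the sphere has the rank of (d theta_f, d theta_g) there. That
    tangent space is the orthogonal of p, and restricting linear forms to the
    orthogonal of a nonzero vector lowers the rank of the family {p, forms}
    by exactly one ([rank_on_orthogonal], [sphere_diff_rank_phases]). So p is
    singular iff p, grad theta_f, grad theta_g are dependent.

    It remains to recognise these gradients: in real coordinates v_h is exactly
    grad theta ([real_coords_v_vec]); the derivatives of Re (log h) = ln |h|
    cancel in the definition of v_h, by algebra alone.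

    A branch of log h is only assumed continuous. That its imaginary part is
    differentiable follows from that of h: near p the variation of theta is the
    arctangent of a quotient of two real-linear functions of h
    ([local_log_im_differentiable]). *)

(** * Ranks and linear dependence *)

Lemma free_row_free (K : fieldType) N (s : seq 'rV[K]_N) :
  free s = row_free (\matrix_(i < size s) s`_i).
Proof.
apply/idP/idP => [/(freeP (X := in_tuple s)) s_free|s_free].
  rewrite -kermx_eq0; apply/rowV0P => v /sub_kermxP.
  rewrite mulmx_sum_row => sum0; apply/rowP => i; rewrite mxE.
  apply: (s_free (v 0)); rewrite -[RHS]sum0.
  by apply: eq_bigr => j _; rewrite rowK.
apply/(freeP (X := in_tuple s)) => k sum0 i.
suff /rowP/(_ i) : \row_j k j = 0 by rewrite !mxE.
apply: (row_free_inj s_free); rewrite mul0mx mulmx_sum_row -[RHS]sum0.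
by apply: eq_bigr => j _; rewrite rowK mxE.
Qed.

(** Both sides are computed by the rank-nullity formula: the vectors of the
    orthogonal of u killed by A form the kernel of the matrix with rows u and
    those of A, while the orthogonal itself has codimension one. *)
Lemma rank_on_orthogonal (K : fieldType) N m (u : 'rV[K]_N) (A : 'M[K]_(m, N)) :
  u != 0 -> (\rank (kermx u^T *m A^T)).+1 = \rank (col_mx u A).
Proof.
move=> u0; have ru : \rank u = 1%N by rewrite rank_rV u0.
have := mxrank_mul_ker (kermx u^T) A^T.
have -> : \rank (kermx u^T :&: kermx A^T)%MS = (N - \rank (col_mx u A))%N.
  rewrite -[in RHS]mxrank_tr tr_col_mx -mxrank_ker; apply/eqmx_rank/eqmxP.
  apply/eqmxP/rV_eqP => v.
  by rewrite sub_capmx !sub_kermx mul_mx_row row_mx_eq0.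
rewrite mxrank_ker mxrank_tr ru.
have := rank_leq_col (col_mx u A).
have : (1 <= N)%N by rewrite -ru rank_leq_col.
have : (1 <= \rank (col_mx u A))%N.
  by rewrite -[X in (X <= _)%N]ru mxrankS // -addsmxE addsmxSl.
lia.
Qed.

(** * Differentiability *)

(** The differential depends on the germ only; this gives access to functions
    that are known through a formula valid near a point. *)
Lemma near_eq_differentiable (R : numFieldType) (V W : normedModType R)
    (f g : V -> W) (x : V) :
  (\forall y \near x, f y = g y) -> differentiable f x -> differentiable g x.
Proof.
move=> fg df.
have dg : g \o shift x = cst (g x) + 'd f x +o_ 0 id.
  have /eqaddoP dfo := diff_locally df.
  apply/eqaddoP => e e0; move: fg (dfo e e0) (nbhs_singleton fg).
  rewrite (near_shift 0 x) subr0 => fg0 dfe fgx.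
  by apply: filterS2 fg0 dfe => h; rewrite !fctE /= fgx => ->.
apply/diff_locallyP; rewrite (diff_unique (diff_continuous df) dg); split => //.
exact: diff_continuous.
Qed.

Lemma differentiable_mx (R : realFieldType) (V : normedModType R) m n
    (M : V -> 'M[R]_(m, n)) (x : V) :
  (forall i j, differentiable (fun y => M y i j) x) -> differentiable M x.
Proof.
move=> dM.
have -> : M = \sum_i \sum_j (fun y => M y i j *: delta_mx i j).
  apply/funext => y; rewrite fct_sumE [LHS]matrix_sum_delta.
  by apply: eq_bigr => i _; rewrite fct_sumE.
by do 2![apply: differentiable_sum => ?]; exact: differentiableZl.
Qed.

Lemma real_coordsK (R : realType) n : cancel (@real_coords R n) (@of_real_coords R n).
Proof.
by move=> z; apply/rowP => j; rewrite mxE row_mxEl row_mxEr !mxE; case: (z 0 j).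
Qed.

Definition cdifferentiable (R : realType) n (h : 'rV[R[i]]_n -> R[i])
    (x : 'rV[R]_(n + n)) : Prop :=
  differentiable (re_fun h) x /\ differentiable (im_fun h) x.

Section CDifferentiable.
Variables (R : realType) (n : nat) (x : 'rV[R]_(n + n)).
Implicit Types h : 'rV[R[i]]_n -> R[i].

Lemma cdifferentiable_cst c : cdifferentiable (fun=> c : R[i]) x.
Proof. by split; exact: differentiable_cst. Qed.

Lemma cdifferentiableD h1 h2 : cdifferentiable h1 x -> cdifferentiable h2 x ->
  cdifferentiable (fun z => h1 z + h2 z) x.
Proof.
move=> [r1 i1] [r2 i2]; split.
- have -> : re_fun (fun z => h1 z + h2 z) = re_fun h1 + re_fun h2.
    by apply/funext => y; rewrite /re_fun fctE raddfD.
  exact: differentiableD.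
- have -> : im_fun (fun z => h1 z + h2 z) = im_fun h1 + im_fun h2.
    by apply/funext => y; rewrite /im_fun fctE raddfD.
  exact: differentiableD.
Qed.

Lemma cdifferentiableM h1 h2 : cdifferentiable h1 x -> cdifferentiable h2 x ->
  cdifferentiable (fun z => h1 z * h2 z) x.
Proof.
move=> [r1 i1] [r2 i2]; split.
- have -> : re_fun (fun z => h1 z * h2 z) =
      re_fun h1 * re_fun h2 - im_fun h1 * im_fun h2.
    by apply/funext => y; rewrite /re_fun /im_fun !fctE; case: (h1 _) (h2 _) => ? ? [].
  by apply: differentiableB; exact: differentiableM.
- have -> : im_fun (fun z => h1 z * h2 z) =
      re_fun h1 * im_fun h2 + im_fun h1 * re_fun h2.
    by apply/funext => y; rewrite /re_fun /im_fun !fctE; case: (h1 _) (h2 _) => ? ? [].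
  by apply: differentiableD; exact: differentiableM.
Qed.

Lemma cdifferentiableX h e : cdifferentiable h x ->
  cdifferentiable (fun z => h z ^+ e) x.
Proof.
move=> dh; elim: e => [|e IH]; first exact: cdifferentiable_cst.
have -> : (fun z => h z ^+ e.+1) = fun z => h z * h z ^+ e.
  by apply/funext => z; rewrite exprS.
exact: cdifferentiableM.
Qed.

Lemma cdifferentiable_conj h : cdifferentiable h x ->
  cdifferentiable (fun z => (h z)^*%C) x.
Proof.
move=> [dr di]; split.
- have -> : re_fun (fun z => (h z)^*%C) = re_fun h.
    by apply/funext => y; rewrite /re_fun; case: (h _).
  exact: dr.
- have -> : im_fun (fun z => (h z)^*%C) = - im_fun h.
    by apply/funext => y; rewrite /im_fun fctE; case: (h _).
  exact: differentiableN.
Qed.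

Lemma cdifferentiable_coord j : cdifferentiable (fun z : 'rV[R[i]]_n => z 0 j) x.
Proof.
split.
- have -> : re_fun (fun z : 'rV[R[i]]_n => z 0 j) = fun y => y 0 (lshift n j).
    by apply/funext => y; rewrite /re_fun mxE.
  exact: differentiable_coord.
- have -> : im_fun (fun z : 'rV[R[i]]_n => z 0 j) = fun y => y 0 (rshift n j).
    by apply/funext => y; rewrite /im_fun mxE.
  exact: differentiable_coord.
Qed.

(** A mixed polynomial is built from the real-differentiable functions z_j and
    their conjugates by sums and products. *)
Lemma cdifferentiable_mixed_eval (f : mixed_poly R n) :
  cdifferentiable (mixed_eval f) x.
Proof.
pose v (z : 'rV[R[i]]_n) (k : 'I_(n + n)) : R[i] :=
  match fintype.split k with inl j => z 0 j | inr j => (z 0 j)^*%C end.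
have dv k : cdifferentiable (v^~ k) x.
  rewrite /v; case: fintype.split => j; first exact: cdifferentiable_coord.
  exact/cdifferentiable_conj/cdifferentiable_coord.
have -> : mixed_eval f = fun z => \sum_(m <- mpoly.msupp f)
    mpoly.mcoeff m f * \prod_k v z k ^+ mpoly.fun_of_multinom m k.
  by apply/funext => z; exact: mpoly.mevalE.
have dprod e (r : seq 'I_(n + n)) :
    cdifferentiable (fun z => \prod_(k <- r) v z k ^+ e k) x.
  elim: r => [|k r IH].
    under [X in cdifferentiable X]eq_fun do rewrite big_nil.
    exact: cdifferentiable_cst.
  under [X in cdifferentiable X]eq_fun do rewrite big_cons.
  by apply: cdifferentiableM => //; exact: cdifferentiableX.
elim: (mpoly.msupp _) => [|m r IH].
  under [X in cdifferentiable X]eq_fun do rewrite big_nil.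
  exact: cdifferentiable_cst.
under [X in cdifferentiable X]eq_fun do rewrite big_cons.
apply: cdifferentiableD => //; apply: cdifferentiableM.
  exact: cdifferentiable_cst.
exact: dprod.
Qed.

End CDifferentiable.

(** * Branches of the logarithm *)

Lemma phase_of_cexp (R : realType) (w : R[i]) :
  cexp w / `|cexp w| = cos (complex.Im w) +i* sin (complex.Im w).
Proof.
have e0 : (expR (complex.Re w))%:C != 0 :> R[i].
  by rewrite (inj_eq (@complexI R)) gt_eqF ?expR_gt0.
have u1 : `|cos (complex.Im w) +i* sin (complex.Im w)| = 1 :> R[i].
  by rewrite normc_def /= cos2Dsin2 sqrtr1.
rewrite /cexp normrM u1 mulr1 normc_def /= expr0n addr0 sqrtr_sqr.
by rewrite ger0_norm ?expR_ge0 // mulrAC mulfV // mul1r.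
Qed.

(** With theta = Im L, the number h x * conj (h q) has argument
    theta x - theta q. Continuity of theta keeps this angle within
    (-pi/2, pi/2) for x near q, where it is the arctangent of the quotient of
    the imaginary part by the real part; that quotient is differentiable since
    h is. *)
Lemma local_log_im_differentiable (R : realType) n (h L : 'rV[R[i]]_n -> R[i])
    (p : 'rV[R[i]]_n) :
  cdifferentiable h (real_coords p) -> is_local_log h p L ->
  differentiable (im_fun L) (real_coords p).
Proof.
move=> [dr di] Llog; set q := real_coords p in dr di Llog *.
have [_ cq hq] := nbhs_singleton Llog.
pose rho := re_fun L; pose theta := im_fun L.
pose re0 := re_fun h q; pose im0 := im_fun h q.
(* the real and imaginary parts of h x * conj (h q) *)
pose A := re0 \*: re_fun h + im0 \*: im_fun h.
pose B := re0 \*: im_fun h - im0 \*: re_fun h.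
have AE x : cexp (L (of_real_coords x)) = h (of_real_coords x) ->
  A x = expR (rho x + rho q) * cos (theta x - theta q).
  move=> hx.
  rewrite /A !fctE /= /re0 /im0 /re_fun /im_fun -hx -hq /cexp /= cosB expRD.
  rewrite !mul0r !subr0 !addr0 /rho /theta /re_fun /im_fun /=.
  by rewrite /GRing.scale /=; ring.
have BE x : cexp (L (of_real_coords x)) = h (of_real_coords x) ->
  B x = expR (rho x + rho q) * sin (theta x - theta q).
  move=> hx.
  rewrite /B !fctE /= /re0 /im0 /re_fun /im_fun -hx -hq /cexp /= sinB expRD.
  rewrite !mul0r !subr0 !addr0 /rho /theta /re_fun /im_fun /=.
  by rewrite /GRing.scale /=; ring.
have Aq : A q != 0.
  by rewrite AE // subrr cos0 mulr1 gt_eqF ?expR_gt0.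
have dtheta : differentiable (fun x => theta q + atan (B x / A x)) q.
  apply: differentiableD; first exact: differentiable_cst.
  apply: (@differentiable_comp _ _ _ _ (fun x => B x / A x) (@atan R)).
    apply: differentiableM; last apply: differentiableV => //.
      by apply: differentiableB; exact: differentiableZ.
    by apply: differentiableD; exact: differentiableZ.
  by apply/derivable1_diffP; exact: derivable_atan.
apply: near_eq_differentiable dtheta.
have pi2 : 0 < pi / 2 :> R by rewrite divr_gt0 ?pi_gt0.
have close : \forall x \near q, `|theta q - theta x| < pi / 2.
  by move/cvgrPdist_lt : cq; apply.
apply: filterS2 Llog close => x [_ _ hx].
rewrite distrC ltr_norml => thetax.
rewrite AE // BE // -mulf_div mulfV ?gt_eqF ?expR_gt0 // mul1r.
by rewrite -[_ / _]/(tan _) tanK ?in_itv // addrC subrK.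
Qed.

(** * The rank of a map given by phases *)

Definition gradient (R : realType) N (phi : 'rV[R]_N -> R) (x : 'rV[R]_N) :
    'rV[R]_N := \row_j 'D_(delta_mx 0 j) phi x.

(** Writing L = rho + i theta, the conjugate of dL/dz_j is
    ((rho_x + theta_y) - i (theta_x - rho_y)) / 2 and dL/dzbar_j is
    ((rho_x - theta_y) + i (theta_x + rho_y)) / 2, where x and y stand for the
    coordinates of z_j; i times their difference is theta_x + i theta_y. *)
Lemma real_coords_v_vec (R : realType) n (L : 'rV[R[i]]_n -> R[i]) p :
  real_coords (v_vec L p) = gradient (im_fun L) (real_coords p).
Proof.
apply/rowP => k; rewrite -(splitK k) [RHS]mxE.
have half : (2%:R : R[i])^-1 = (2^-1 : R)%:C by rewrite fmorphV /= rmorph_nat.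
case: (fintype.split k) => j /=; rewrite ?row_mxEl ?row_mxEr !mxE.
- rewrite /wirtinger /wirtinger_bar /d_x /d_y /real_dderive half /=.
  by simpc => /=; field.
- rewrite /wirtinger /wirtinger_bar /d_x /d_y /real_dderive half /=.
  by simpc => /=; field.
Qed.

(** For a map into a torus that reads (exp(i theta_k))_k near p. Its Jacobian
    is the transposed matrix of the gradients times that of the differential of
    (t_k)_k |-> (exp(i t_k))_k, which does not affect the rank; the rest is the
    rank formula for the orthogonal of p. *)
Lemma sphere_diff_rank_phases (R : realType) n m
    (F : 'rV[R[i]]_n -> 'rV[R[i]]_m) (p : 'rV[R[i]]_n)
    (theta : 'I_m -> 'rV[R]_(n + n) -> R) :
  p != 0 ->
  (forall k, differentiable (theta k) (real_coords p)) ->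
  (\forall x \near real_coords p, forall k,
     F (of_real_coords x) 0 k = cos (theta k x) +i* sin (theta k x)) ->
  (sphere_diff_rank F p).+1 =
  \rank (col_mx (real_coords p)
                (\matrix_k gradient (theta k) (real_coords p))).
Proof.
move=> p0 dtheta Fphase; set q := real_coords p in dtheta Fphase *.
pose c := \row_k cos (theta k q); pose s := \row_k sin (theta k q).
pose G := \matrix_k gradient (theta k) q; rewrite -/G.
pose E (x : 'rV[R]_(n + n)) : 'rV[R]_(m + m) :=
  row_mx (\row_k cos (theta k x)) (\row_k sin (theta k x)).
have FE : \forall x \near q, E x = realify F x.
  apply: filterS Fphase => x Fx; rewrite /E /realify /real_coords.
  by congr row_mx; apply/rowP => k; rewrite !mxE Fx.
have dcos k : differentiable (cos \o theta k) q.
  by apply: differentiable_comp => //; apply/derivable1_diffP/derivable_cos.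
have dsin k : differentiable (sin \o theta k) q.
  by apply: differentiable_comp => //; apply/derivable1_diffP/derivable_sin.
have dE : differentiable E q.
  apply: differentiable_mx => i k; rewrite ord1 -(splitK k).
  case: (fintype.split k) => j /=.
  - rewrite (_ : (fun x => _) = cos \o theta j) //.
    by apply/funext => x; rewrite /E row_mxEl mxE.
  - rewrite (_ : (fun x => _) = sin \o theta j) //.
    by apply/funext => x; rewrite /E row_mxEr mxE.
have dF := near_eq_differentiable FE dE.
(* the differential of (t_k)_k |-> (exp(i t_k))_k at (theta_k q)_k *)
pose B := row_mx (diag_mx (- s)) (diag_mx c).
have JE : jacobian (realify F) q = G^T *m B.
  apply/row_matrixP => i; rewrite rowE -(deriveEjacobian _ dF).
  rewrite -(near_eq_derive _ FE) derive_mx; last exact: diff_derivable.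
  rewrite row_mul; apply/rowP => k; rewrite -(splitK k) mul_mx_row.
  rewrite mxE; case: (fintype.split k) => j /=.
  - rewrite (_ : (fun x => _) = cos \o theta j); last first.
      by apply/funext => x; rewrite /E row_mxEl mxE.
    rewrite row_mxEl mul_mx_diag !mxE deriveE // diff_comp //=; last first.
      exact/derivable1_diffP/derivable_cos.
    rewrite -(deriveE _ (dtheta j)) deriv1E; last exact: derivable_cos.
    by rewrite derive1E derive_val.
  - rewrite (_ : (fun x => _) = sin \o theta j); last first.
      by apply/funext => x; rewrite /E row_mxEr mxE.
    rewrite row_mxEr mul_mx_diag !mxE deriveE // diff_comp //=; last first.
      exact/derivable1_diffP/derivable_sin.
    rewrite -(deriveE _ (dtheta j)) deriv1E; last exact: derivable_sin.
    by rewrite derive1E derive_val.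
(* B has orthonormal rows, since cos^2 + sin^2 = 1 *)
have Bfree : row_free B.
  apply/row_freeP; exists B^T.
  rewrite tr_row_mx mul_row_col !tr_diag_mx !mulmx_diag -raddfD /=.
  apply/matrixP => i j; rewrite !mxE; congr (_ *+ _).
  by rewrite -!expr2 sqrrN addrC cos2Dsin2.
have q0 : q != 0.
  apply: contra p0 => /eqP q0; rewrite -(real_coordsK p) -/q q0.
  by apply/eqP/rowP => j; rewrite !mxE.
by rewrite /sphere_diff_rank -/q JE mulmxA mxrankMfree // rank_on_orthogonal.
Qed.

(** * Singular points of the product map *)

Theorem proposition3p2 (R : realType) (n : nat) (f g : mixed_poly R n)
    (eps : R) (p : 'rV[R[i]]_n) (log_f log_g : 'rV[R[i]]_n -> R[i]) :
  0 < eps ->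
  (csphere eps `\` milnor_link f g eps) p ->
  is_local_log (mixed_eval f) p log_f ->
  is_local_log (mixed_eval g) p log_g ->
  sphere_singular_point (milnor_product_map f g) p <->
  real_dependent [:: p; v_vec log_f p; v_vec log_g p].
Proof.
move=> eps0 [p_eps _] Lf Lg.
have p0 : p != 0.
  apply/eqP => p0; move: p_eps eps0; rewrite /csphere /= /enorm p0 => <-.
  by rewrite big1 ?sqrtr0 ?ltxx // => j _; rewrite mxE /= expr0n addr0.
pose log_ (k : 'I_2) := if k == 0 then log_f else log_g.
have rank_eq : (sphere_diff_rank (milnor_product_map f g) p).+1 = \rank (col_mx
    (real_coords p) (\matrix_k gradient (im_fun (log_ k)) (real_coords p))).
  apply: sphere_diff_rank_phases => // [k|].
    rewrite /log_; case: eqP => _.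
      exact: local_log_im_differentiable (cdifferentiable_mixed_eval _ _) Lf.
    exact: local_log_im_differentiable (cdifferentiable_mixed_eval _ _) Lg.
  apply: filterS2 Lf Lg => x [_ _ fx] [_ _ gx] k.
  rewrite /milnor_product_map mxE /log_ -fx -gx.
  by case: eqP => _; rewrite phase_of_cexp.
rewrite /sphere_singular_point /real_dependent -ltnS rank_eq.
set s := map _ _.
have -> : col_mx (real_coords p)
    (\matrix_k gradient (im_fun (log_ k)) (real_coords p)) =
    \matrix_(i < size s) s`_i.
  apply/row_matrixP => i; rewrite rowK -(splitK (i : 'I_(1 + 2))).
  case: (fintype.split _) => k /=.
    by rewrite rowKu ord1 row_id.
  by rewrite rowKd rowK -real_coords_v_vec; case: k => [[|[|]]].
by rewrite free_row_free /row_free ltn_neqAle rank_leq_row andbT.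
Qed.
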